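(* Let $k$ and $n$ be positive integers, let $x_1,x_2,\ldots,x_{k+1}$ be real numbers and let $q>0$ be a real number with $q\neq 1$. For nonnegative integers $r_1,\ldots,r_k$ with $\sum_{i=1}^k r_i\le n$ put $s_j=\sum_{i=1}^j r_i$ for $j=1,\ldots,k$ and $r_{k+1}=n-s_k$; also put $z_j=\sum_{i=j+1}^{k+1}x_i$ for $j=1,\ldots,k$. Then the following four identities hold, where each sum extends over all $r_j\in\{0,1,\ldots,n\}$, $j=1,\ldots,k$, with $\sum_{i=1}^k r_i\le n$: $$\begin{bmatrix}x_1+x_2+\cdots+x_{k+1}\\ n\end{bmatrix}_q=\sum q^{\sum_{j=1}^{k}(n-s_j)(x_j-r_j)}\prod_{j=1}^{k+1}\begin{bmatrix}x_j\\ r_j\end{bmatrix}_q,$$ $$\begin{bmatrix}x_1+x_2+\cdots+x_{k+1}+n-1\\ n\end{bmatrix}_q=\sum q^{\sum_{j=1}^{k}r_jz_j}\prod_{j=1}^{k+1}\begin{bmatrix}x_j+r_j-1\\ r_j\end{bmatrix}_q,$$ $$\begin{bmatrix}x_1+x_2+\cdots+x_{k+1}\\ n\end{bmatrix}_q=\sum q^{\sum_{j=1}^{k}r_j(z_j-(n-s_j))}\prod_{j=1}^{k+1}\begin{bmatrix}x_j\\ r_j\end{bmatrix}_q,$$ $$\begin{bmatrix}x_1+x_2+\cdots+x_{k+1}+n-1\\ n\end{bmatrix}_q=\sum q^{\sum_{j=1}^{k}x_j(n-s_j)}\prod_{j=1}^{k+1}\begin{bmatrix}x_j+r_j-1\\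 r_j\end{bmatrix}_q.$$
   Context: For real $x$ and real $q>0$, $q\ne1$: the $q$-number is $[x]_q=(1-q^x)/(1-q)$; the $q$-factorial of $x$ of order $r$ is $[x]_{r,q}=[x]_q[x-1]_q\cdots[x-r+1]_q$ for $r=1,2,\ldots$, and $[x]_{0,q}=1$; and $[r]_q!=[1]_q[2]_q\cdots[r]_q$ (with $[0]_q!=1$). The $q$-binomial coefficient, for real $x$ and nonnegative integer $r$, is $\begin{bmatrix}x\\ r\end{bmatrix}_q=[x]_{r,q}/[r]_q!$. *)

(* Defs.v *)
From HB Require Import structures.
From mathcomp Require Import all_boot all_order all_algebra.
From mathcomp Require Import reals exp.
Set Implicit Arguments.
Unset Strict Implicit.
Unset Printing Implicit Defensive.
Import Order.TTheory GRing.Theory Num.Theory.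
Local Open Scope ring_scope.

Section QBinomial.
Context {R : realType}.

Definition qnum (q x : R) : R := (1 - q `^ x) / (1 - q).

Definition qffact (q x : R) (r : nat) : R := \prod_(i < r) qnum q (x - i%:R).

Definition qfact (q : R) (r : nat) : R := \prod_(1 <= i < r.+1) qnum q i%:R.

Definition qbinom (q x : R) (r : nat) : R := qffact q x r / qfact q r.

End QBinomial.

(* Indices are shifted down by one: the index j = 1..k is represented by
   j - 1 : 'I_k, and j = 1..k+1 by j - 1 : 'I_k.+1. The embedding of the former
   into the latter is [lift ord_max], and k+1 is represented by [ord_max]. *)

(* s_j = r_1 + ... + r_j *)
Definition psum (k n : nat) (r : {ffun 'I_k -> 'I_n.+1}) (j : 'I_k) : nat :=
  (\sum_(i < k | (i <= j)%N) r i)%N.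

(* (r_1, ..., r_k, r_{k+1}) with r_{k+1} = n - s_k; the truncated subtraction
   is exact whenever r_1 + ... + r_k <= n. *)
Definition extend (k n : nat) (r : {ffun 'I_k -> 'I_n.+1}) (j : 'I_k.+1) : nat :=
  if unlift ord_max j is Some i then r i : nat else (n - \sum_(i < k) r i)%N.

(* z_j = x_{j+1} + ... + x_{k+1} *)
Definition tailsum {R : realType} (k : nat) (x : 'I_k.+1 -> R) (j : 'I_k) : R :=
  \sum_(i < k.+1 | (j < i)%N) x i.

(* Main.v *)
Require Import Defs.
From HB Require Import structures.
From mathcomp Require Import all_boot all_order all_algebra.
From mathcomp Require Import reals exp.
From mathcomp Require Import ring.
Set Implicit Arguments.
Unset Strict Implicit.
Unset Printing Implicit Defensive.
Import Order.TTheory GRing.Theory Num.Theory.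
Local Open Scope ring_scope.

(* Each identity is a k-fold iteration of its case k = 1, a convolution of the
   form f (x + y) n = \sum_r w x y r (n - r) * (f x r * f y (n - r)). There,
   f x satisfies a first-order recurrence with coefficients qnum q n, and the
   case k = 1 follows by induction on n: the q-number of n = r + m splits as
   [r + m] = [r] + q^r [m] = q^m [r] + [m], and applying the recurrence to
   either factor produces the recurrence for f (x + y). *)

(** [u] and [v] are the coefficients of [d r] and [d m] in [d (r + m) * w r m], left general so that
    both splittings of the q-number fit. *)
Lemma convolution_recurrence (F : fieldType) (d a b c : nat -> F)
    (w u v : nat -> nat -> F) (A B C : nat -> F) :
  d 0%N = 0 -> (forall n, d n.+1 != 0) ->
  (forall n, d n.+1 * A n.+1 = a n * A n) ->
  (forall n, d n.+1 * B n.+1 = b n * B n) ->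
  (forall n, d n.+1 * C n.+1 = c n * C n) ->
  C 0%N = w 0%N 0%N * (A 0%N * B 0%N) ->
  (forall r m, d (r + m)%N * w r m = u r m * d r + v r m * d m) ->
  (forall r m, u r.+1 m * a r + v r m.+1 * b m = c (r + m)%N * w r m) ->
  forall n, C n = \sum_(r < n.+1) w r (n - r)%N * (A r * B (n - r)%N).
Proof.
move=> d0 dS AS BS CS C0 dw uv; elim=> [|n IHn]; first by rewrite big_ord1.
apply: (mulfI (dS n)); rewrite CS IHn !mulr_sumr.
under [RHS]eq_bigr => r _.
  have -> : d n.+1 * (w r (n.+1 - r)%N * (A r * B (n.+1 - r)%N)) =
      u r (n.+1 - r)%N * (d r * A r) * B (n.+1 - r)%N
      + v r (n.+1 - r)%N * A r * (d (n.+1 - r)%N * B (n.+1 - r)%N).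
    have := dw r (n.+1 - r)%N; rewrite subnKC -1?ltnS // => e.
    by rewrite mulrA e; ring.
  over.
(* The term r = 0 of the first sum and r = n + 1 of the second vanish by [d 0 = 0]. Shifting the
   first sum by one then leaves the product [A r * B (n - r)] in both, and [uv] merges the
   coefficients. *)
rewrite big_split /= [X in _ = X + _]big_ord_recl /= d0 mul0r mulr0 mul0r add0r.
rewrite [X in _ = _ + X]big_ord_recr /= subnn d0 mul0r mulr0 addr0 -big_split /=.
apply: eq_bigr => r _; have le_rn : (r <= n)%N by rewrite -ltnS.
rewrite /bump /= add1n subSS AS subSn // BS.
have := uv r (n - r)%N; rewrite subnKC // => e.
by rewrite mulrA -e; ring.
Qed.

(** [cons] is a bijection, inverted by taking the value at [ord0] and the restriction to the other
    indices. It isolates the first entry of a tuple for the induction on [k]. *)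
Lemma big_ffun_ord_recl (F : nmodType) (T : finType) (k : nat)
    (P : pred {ffun 'I_k.+1 -> T}) (G : {ffun 'I_k.+1 -> T} -> F) :
  let cons t (r : {ffun 'I_k -> T}) := [ffun i => oapp r t (unlift ord0 i)] in
  \sum_(r | P r) G r = \sum_t \sum_(r | P (cons t r)) G (cons t r).
Proof.
move=> cons; rewrite pair_big_dep /= (reindex (fun p => cons p.1 p.2)) //=.
exists (fun r => (r ord0, [ffun i => r (lift ord0 i)])) => [[t r] _|r _] /=.
  congr (_, _); first by rewrite ffunE unlift_none.
  by apply/ffunP => i; rewrite !ffunE liftK.
apply/ffunP => i; rewrite ffunE; case: unliftP => [j|] -> //=.
by rewrite ffunE.
Qed.

(* The bound N on the r_j is decoupled from n, because peeling off r_1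
   replaces n by n - r_1 while the index type stays the same. *)
Lemma iterated_convolution (V : nmodType) (F : comNzRingType)
    (f : V -> nat -> F) (w : V -> V -> nat -> nat -> F) :
  (forall x y n, f (x + y) n =
     \sum_(r < n.+1) w x y r (n - r)%N * (f x r * f y (n - r)%N)) ->
  forall (N k n : nat) (x : 'I_k.+1 -> V), (n <= N)%N ->
  f (\sum_(j < k.+1) x j) n =
    \sum_(r : {ffun 'I_k -> 'I_N.+1} | (\sum_(i < k) r i <= n)%N)
      (\prod_(j < k) w (x (lift ord_max j)) (\sum_(i < k.+1 | (j < i)%N) x i)
                       (r j) (n - \sum_(i < k | (i <= j)%N) r i)%N)
      * \prod_(j < k.+1) f (x j)
          (if unlift ord_max j is Some i then r i : nat
           else (n - \sum_(i < k) r i)%N).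
Proof.
move=> fD N; elim=> [|k IHk] n x le_nN.
  rewrite big_ord1 (big_pred1 [ffun=> ord0]) => [|r].
    by rewrite big_ord0 mul1r !big_ord1; case: unliftP => [[]//|_];
      rewrite big_ord0 subn0.
  by rewrite big_ord0 leq0n; apply/esym/eqP/ffunP => -[].
rewrite big_ord_recl fD big_ffun_ord_recl.
set X := \sum_(i < k.+1) x (lift ord0 i).
rewrite (big_ord_widen N.+1 (fun r => w (x ord0) X r (n - r)%N *
  (f (x ord0) r * f X (n - r)%N))) // {2}/X.
rewrite big_mkcond; apply: eq_bigr => t _; rewrite ltnS.
have sum_cons (r : {ffun 'I_k -> 'I_N.+1}) :
    (\sum_(i < k.+1) [ffun i => oapp r t (unlift ord0 i)] i
     = t + \sum_(i < k) r i)%N.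
  rewrite big_ord_recl ffunE unlift_none /=; congr addn.
  by apply: eq_bigr => i _; rewrite ffunE liftK.
(* For t > n no tuple starting with [t] meets the constraint, which matches the zero terms added by
   widening the range from [n] to [N]. *)
case: leqP => [le_tn | lt_nt]; last first.
  rewrite big_pred0 // => r; rewrite sum_cons; apply/negbTE.
  by rewrite -ltnNge ltn_addr.
rewrite (IHk (n - t)%N) ?(leq_trans (leq_subr _ _)) // !mulr_sumr.
apply: eq_big => [r | r _]; first by rewrite sum_cons leq_subRL.
rewrite [X in _ = X * _]big_ord_recl [X in _ = _ * X]big_ord_recl.
rewrite sum_cons.
have -> : lift ord_max ord0 = ord0 :> 'I_k.+2 by apply: val_inj.
have lift_comm (j : 'I_k) :
    lift ord_max (lift ord0 j) = lift ord0 (lift ord_max j).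
  by apply: val_inj; rewrite /= /bump /= !add1n ltnS addnS.
have max0 : unlift ord_max ord0 = Some ord0 :> option 'I_k.+1.
  by case: unliftP => [j /(congr1 val)/=|/(congr1 val)//];
    rewrite /bump leqNgt ltn_ord => e; congr Some; apply: val_inj.
rewrite max0 !ffunE unlift_none /=.
have e1 : \sum_(i < k.+2 | (0 < i)%N) x i = \sum_(i < k.+1) x (lift ord0 i).
  by rewrite big_mkcond big_ord_recl /= add0r.
have e2 : (\sum_(i < k.+1 | (i <= 0)%N)
    [ffun i => oapp r t (unlift ord0 i)] i = t)%N.
  rewrite big_mkcond big_ord_recl /= ffunE unlift_none /= big1 ?addn0 //.
(* The factors [w] and [f] of the first variable agree; the remaining products match through (n - t)
   - s = n - (t + s), where s is a sum of entries of the shorter tuple. *)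
rewrite e1 e2 [RHS]mulrACA [LHS]mulrA; congr (_ * _ * (_ * _)).
  apply: eq_bigr => j _; rewrite lift_comm ffunE liftK /=; congr w.
    by rewrite [RHS]big_mkcond big_ord_recl /= add0r -big_mkcond.
  rewrite -subnDA; congr (_ - _)%N.
  rewrite [RHS]big_mkcond big_ord_recl /= ffunE unlift_none /= -big_mkcond.
  by congr addn; apply: eq_big => // i _; rewrite ffunE liftK.
apply: eq_bigr => j _; congr f; case: unliftP => [i|] ->.
  by rewrite -lift_comm liftK ffunE liftK.
have -> : lift ord0 ord_max = ord_max :> 'I_k.+2 by apply: val_inj.
by rewrite unlift_none subnDA.
Qed.

Section QNumbers.
Context {R : realType} (q : R).
Hypotheses (q_gt0 : 0 < q) (q_neq1 : q != 1).

Let powRD_gt0 (x y : R) : q `^ (x + y) = q `^ x * q `^ y.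
Proof. by rewrite powRD // (gt_eqF q_gt0) implybT. Qed.

Lemma powR_sum (I : Type) (s : seq I) (P : pred I) (E : I -> R) :
  q `^ (\sum_(i <- s | P i) E i) = \prod_(i <- s | P i) q `^ E i.
Proof. by apply: (big_morph _ powRD_gt0); rewrite powRr0. Qed.

(** Serves twice: on naturals it splits the q-number of r + m, on reals it recombines the
    coefficients of the two recurrences. *)
Lemma qnumD (x y : R) : qnum q (x + y) = qnum q x + q `^ x * qnum q y.
Proof. by rewrite /qnum powRD_gt0; ring. Qed.

Lemma qnum0 : qnum q 0 = 0.
Proof. by rewrite /qnum powRr0 subrr mul0r. Qed.

Lemma qnum_natS_neq0 (n : nat) : qnum q n.+1%:R != 0.
Proof.
rewrite mulf_neq0 ?invr_eq0 ?subr_eq0 1?eq_sym //.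
by rewrite powR_mulrn ?ltW // pexpr_eq1 ?ltW // eq_sym.
Qed.

Lemma qbinom0 (x : R) : qbinom q x 0 = 1.
Proof. by rewrite /qbinom /qffact /qfact big_ord0 big_nil divr1. Qed.

(** Cancelling the last factor of the q-factorial reduces each recurrence below to splitting one
    factor off [qffact]. *)
Let qbinom_div (N x : R) (n : nat) :
  qffact q x n.+1 = N -> qnum q n.+1%:R * qbinom q x n.+1 = N / qfact q n.
Proof.
move=> <-; rewrite /qbinom /qfact big_nat_recr //= invfM mulrCA.
by congr (_ * _); rewrite mulrCA mulfV ?mulr1 ?qnum_natS_neq0.
Qed.

Lemma qbinomS (x : R) (n : nat) :
  qnum q n.+1%:R * qbinom q x n.+1 = qnum q (x - n%:R) * qbinom q x n.
Proof.
rewrite (@qbinom_div (qnum q (x - n%:R) * qffact q x n)) ?mulrA //.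
by rewrite /qffact big_ord_recr mulrC.
Qed.

(** The argument grows with the order, so the new factor of [qffact] is the first one, not the last
    as in [qbinomS]. *)
Lemma qbinom_risingS (x : R) (n : nat) :
  qnum q n.+1%:R * qbinom q (x + n.+1%:R - 1) n.+1 =
  qnum q (x + n%:R) * qbinom q (x + n%:R - 1) n.
Proof.
rewrite (@qbinom_div (qnum q (x + n%:R) * qffact q (x + n%:R - 1) n)) ?mulrA //.
rewrite /qffact big_ord_recl; congr (qnum q _ * _).
  by rewrite /= -natr1 subr0; ring.
by apply: eq_bigr => i _; congr qnum; rewrite -natr1 /= /bump add1n -natr1; ring.
Qed.

Lemma qbinom_vandermonde (x y : R) (n : nat) :
  qbinom q (x + y) n =
  \sum_(r < n.+1) q `^ (r%:R * (y - (n - r)%N%:R))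
                  * (qbinom q x r * qbinom q y (n - r)%N).
Proof.
pose w (r m : nat) := q `^ (r%:R * (y - m%:R)).
apply: (@convolution_recurrence R (fun n => qnum q n%:R)
  (fun n => qnum q (x - n%:R)) (fun n => qnum q (y - n%:R))
  (fun n => qnum q (x + y - n%:R))
  w w (fun r m => q `^ r%:R * w r m)) => [||i|i|i||r m|r m].
- exact: qnum0.
- exact: qnum_natS_neq0.
- exact: qbinomS.
- exact: qbinomS.
- exact: qbinomS.
- by rewrite !qbinom0 /w mul0r powRr0 !mulr1.
- by rewrite natrD qnumD; ring.
(* Up to the common factor [w r m], what remains is [x + y - (r + m)] = [y - m] + q^(y - m)
   [x - r]. *)
rewrite /w -powRD_gt0.
have -> : x + y - (r + m)%N%:R = (y - m%:R) + (x - r%:R).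
  by rewrite natrD; ring.
have -> : r.+1%:R * (y - m%:R) = r%:R * (y - m%:R) + (y - m%:R).
  by rewrite -natr1; ring.
have -> : r%:R + r%:R * (y - m.+1%:R) = r%:R * (y - m%:R).
  by rewrite -natr1; ring.
by rewrite powRD_gt0 [qnum q (y - _ + _)]qnumD; ring.
Qed.

(** The weight is independent of m, so the splitting [r + m] = q^m [r] + [m] is the suitable one:
    q^m q^y = q^(y + m) is the power needed in [x + y + r + m] = [y + m] + q^(y + m) [x + r]. *)
Lemma qbinom_rising_vandermonde (x y : R) (n : nat) :
  qbinom q (x + y + n%:R - 1) n =
  \sum_(r < n.+1) q `^ (r%:R * y)
                  * (qbinom q (x + r%:R - 1) r
                     * qbinom q (y + (n - r)%N%:R - 1) (n - r)%N).
Proof.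
pose w (r m : nat) := q `^ (r%:R * y).
apply: (@convolution_recurrence R (fun n => qnum q n%:R)
  (fun n => qnum q (x + n%:R)) (fun n => qnum q (y + n%:R))
  (fun n => qnum q (x + y + n%:R))
  w (fun r m => q `^ m%:R * w r m) w
  (fun n => qbinom q (x + n%:R - 1) n) (fun n => qbinom q (y + n%:R - 1) n)
  (fun n => qbinom q (x + y + n%:R - 1) n)) => [||i|i|i||r m|r m].
- exact: qnum0.
- exact: qnum_natS_neq0.
- exact: qbinom_risingS.
- exact: qbinom_risingS.
- exact: qbinom_risingS.
- by rewrite !qbinom0 /w mul0r powRr0 !mulr1.
- by rewrite addnC natrD qnumD; ring.
rewrite /w.
have -> : x + y + (r + m)%N%:R = (y + m%:R) + (x + r%:R) by rewrite natrD; ring.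
have -> : r.+1%:R * y = r%:R * y + y by rewrite -natr1; ring.
by rewrite [qnum q (y + _ + _)]qnumD !powRD_gt0; ring.
Qed.

End QNumbers.

(** Combined with exchanging the two arguments, the reversal turns the weights q^(r (y - m)) and
    q^(r y) into q^(m (x - r)) and q^(m x), those of the first and fourth identities. *)
Lemma sum_ord_rev (F : nmodType) (n : nat) (G : nat -> nat -> F) :
  \sum_(r < n.+1) G r (n - r)%N = \sum_(r < n.+1) G (n - r)%N r.
Proof.
rewrite (reindex_inj rev_ord_inj); apply: eq_bigr => r _ /=.
by rewrite subSS subKn // -ltnS.
Qed.

(** A partial sum is at most the full sum, hence at most [n], so the truncated difference coming
    from the iteration is the real one. *)
Lemma natr_sub_psum (R : realType) (k n : nat) (r : {ffun 'I_k -> 'I_n.+1})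
    (j : 'I_k) : (\sum_(i < k) r i <= n)%N ->
  (n - psum r j)%N%:R = n%:R - (psum r j)%:R :> R.
Proof.
move=> le_rn; rewrite natrB // (leq_trans _ le_rn) // /psum big_mkcond.
by apply: leq_sum => i _; case: ifP.
Qed.

Theorem corollary2p1 (R : realType) (k n : nat) (x : 'I_k.+1 -> R) (q : R)
    (hk : (0 < k)%N) (hn : (0 < n)%N) (hq0 : 0 < q) (hq1 : q != 1) :
  [/\ qbinom q (\sum_(j < k.+1) x j) n =
        \sum_(r : {ffun 'I_k -> 'I_n.+1} | (\sum_(i < k) r i <= n)%N)
          q `^ (\sum_(j < k) (n%:R - (psum r j)%:R)
                             * (x (lift ord_max j) - (r j)%:R))
          * \prod_(j < k.+1) qbinom q (x j) (extend r j),
      qbinom q (\sum_(j < k.+1) x j + n%:R - 1) n =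
        \sum_(r : {ffun 'I_k -> 'I_n.+1} | (\sum_(i < k) r i <= n)%N)
          q `^ (\sum_(j < k) (r j)%:R * tailsum x j)
          * \prod_(j < k.+1)
              qbinom q (x j + (extend r j)%:R - 1) (extend r j),
      qbinom q (\sum_(j < k.+1) x j) n =
        \sum_(r : {ffun 'I_k -> 'I_n.+1} | (\sum_(i < k) r i <= n)%N)
          q `^ (\sum_(j < k) (r j)%:R
                             * (tailsum x j - (n%:R - (psum r j)%:R)))
          * \prod_(j < k.+1) qbinom q (x j) (extend r j)
    & qbinom q (\sum_(j < k.+1) x j + n%:R - 1) n =
        \sum_(r : {ffun 'I_k -> 'I_n.+1} | (\sum_(i < k) r i <= n)%N)
          q `^ (\sum_(j < k) x (lift ord_max j) * (n%:R - (psum r j)%:R))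
          * \prod_(j < k.+1)
              qbinom q (x j + (extend r j)%:R - 1) (extend r j)].
Proof.
(* In each identity the iteration evaluates the weight at x_j, z_j, r_j and n - s_j, and [powR_sum]
   gathers the powers into one exponent. *)
split.
- rewrite (@iterated_convolution _ _ (qbinom q)
    (fun x y r m => q `^ (m%:R * (x - r%:R))) _ n) // => [|y z m].
    apply: eq_bigr => r le_rn; rewrite powR_sum //; congr (_ * _).
    by apply: eq_bigr => j _; rewrite -natr_sub_psum.
  rewrite addrC qbinom_vandermonde //.
  rewrite (sum_ord_rev m (fun r s => q `^ (r%:R * (y - s%:R))
    * (qbinom q z r * qbinom q y s))).
  by apply: eq_bigr => r _; rewrite [qbinom q z _ * _]mulrC.
- rewrite (@iterated_convolution _ _ (fun y m => qbinom q (y + m%:R - 1) m)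
    (fun x y r m => q `^ (r%:R * y)) _ n) // => [|y z m].
    by apply: eq_bigr => r le_rn; rewrite powR_sum.
  exact: qbinom_rising_vandermonde.
- rewrite (@iterated_convolution _ _ (qbinom q)
    (fun x y r m => q `^ (r%:R * (y - m%:R))) _ n) // => [|y z m].
    apply: eq_bigr => r le_rn; rewrite powR_sum //; congr (_ * _).
    by apply: eq_bigr => j _; rewrite -natr_sub_psum.
  exact: qbinom_vandermonde.
- rewrite (@iterated_convolution _ _ (fun y m => qbinom q (y + m%:R - 1) m)
    (fun x y r m => q `^ (x * m%:R)) _ n) // => [|y z m].
    apply: eq_bigr => r le_rn; rewrite powR_sum //; congr (_ * _).
    by apply: eq_bigr => j _; rewrite -natr_sub_psum.
  rewrite [y + z]addrC qbinom_rising_vandermonde //.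
  rewrite (sum_ord_rev m (fun r s => q `^ (r%:R * y)
    * (qbinom q (z + r%:R - 1) r * qbinom q (y + s%:R - 1) s))).
  by apply: eq_bigr => r _; rewrite [_%:R * y]mulrC [X in _ * X]mulrC.
Qed.
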